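(* The system $\mathcal F\left(\begin{matrix}a\\ B\end{matrix};x\right)$ admits the $S_3\times D_4$-symmetry $$\mathcal F\left(\begin{matrix}a\\ B\end{matrix};x_1,x_2\right)=\mathcal F\left(\begin{matrix}a_{\sigma(1)},&a_{\sigma(2)},&a_{\sigma(3)}\\ b_{\tau(1),\sigma_1(1)},&b_{\tau(1),\sigma_1(2)},&1\\ b_{\tau(2),\sigma_2(1)},&b_{\tau(2),\sigma_2(2)},&1\end{matrix}\ ;x_{\tau(1)},x_{\tau(2)}\right)$$ for any $\sigma\in S_3$ and $\sigma_1,\sigma_2,\tau\in S_2$.
   Context: Parameters $a=(a_1,a_2,a_3)$ and $B=\begin{pmatrix}b_{11}&b_{12}&b_{13}\\ b_{21}&b_{22}&b_{23}\end{pmatrix}$ with $b_{13}=b_{23}=1$. $\mathcal F\left(\begin{matrix}a\\ B\end{matrix};x_1,x_2\right)$ is the system of differential equations generated by $\prod_{j=1}^3(b_{ij}-1+\theta_i)f=x_i\prod_{j=1}^3(a_j+\theta_1+\theta_2)f$ for $i=1,2$, where $\theta_i=x_i\partial/\partial x_i$ (i.e. the left ideal of the Weyl algebra in $x_1,x_2$ generated by the corresponding two operators). $D_4$ is the dihedral group of order $8$, realized by the triples $(\sigma_1,\sigma_2;\tau)$ acting on parameters and variables as displayed. *)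

(* Defs.v *)
From HB Require Import structures.
From mathcomp Require Import all_boot all_order all_algebra.
From mathcomp Require Import all_fingroup all_solvable.
From mathcomp Require Import boolp classical_sets reals.
From mathcomp Require Import complex mpoly.

Set Implicit Arguments.
Unset Strict Implicit.
Unset Printing Implicit Defensive.

Import GRing.Theory.
Local Open Scope ring_scope.

(** MathComp has no ring structure on the endomorphisms of a module that need
    not be of finite dimension. *)
Definition lend (K : comNzRingType) (V : lmodType K) := {linear V -> V}.

Section EndomorphismAlgebra.
Variables (K : comNzRingType) (V : lmodType K).
Implicit Types f g h : {linear V -> V}.

HB.instance Definition _ := gen_eqMixin (lend V).
HB.instance Definition _ := gen_choiceMixin (lend V).

Lemma lendP f g : f =1 g -> f = g.
Proof.
case: f g => [f [[fA] [fS]]] [g [[gA] [gS]]] /= /funext fg.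
by case: _ / fg in gA gS *; congr (GRing.Linear.Pack (GRing.Linear.Class _ _));
  congr (_ _); exact: Prop_irrelevance.
Qed.

Definition lend_zero : lend V := \0 : {linear V -> V}.
Definition lend_opp f : lend V := \- f : {linear V -> V}.
Definition lend_add f g : lend V := f \+ g : {linear V -> V}.
Definition lend_one : lend V := idfun : {linear V -> V}.
Definition lend_mul f g : lend V := f \o g : {linear V -> V}.
Definition lend_scale (c : K) f : lend V := c \*: f : {linear V -> V}.

Fact lend_addA : associative lend_add.
Proof. by move=> f g h; apply: lendP => v /=; rewrite addrA. Qed.
Fact lend_addC : commutative lend_add.
Proof. by move=> f g; apply: lendP => v /=; rewrite addrC. Qed.
Fact lend_add0 : left_id lend_zero lend_add.
Proof. by move=> f; apply: lendP => v /=; rewrite add0r. Qed.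
Fact lend_addN : left_inverse lend_zero lend_opp lend_add.
Proof. by move=> f; apply: lendP => v /=; rewrite addNr. Qed.

HB.instance Definition _ :=
  GRing.isZmodule.Build (lend V) lend_addA lend_addC lend_add0 lend_addN.

Fact lend_mulA : associative lend_mul.
Proof. by move=> f g h; apply: lendP. Qed.
Fact lend_mul1l : left_id lend_one lend_mul.
Proof. by move=> f; apply: lendP. Qed.
Fact lend_mul1r : right_id lend_one lend_mul.
Proof. by move=> f; apply: lendP. Qed.
Fact lend_mulDl : left_distributive lend_mul lend_add.
Proof. by move=> f g h; apply: lendP. Qed.
Fact lend_mulDr : right_distributive lend_mul lend_add.
Proof. by move=> f g h; apply: lendP => v /=; rewrite linearD. Qed.

HB.instance Definition _ := GRing.Zmodule_isPzRing.Build (lend V)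
  lend_mulA lend_mul1l lend_mul1r lend_mulDl lend_mulDr.

Fact lend_scaleA c d f : lend_scale c (lend_scale d f) = lend_scale (c * d) f.
Proof. by apply: lendP => v /=; rewrite scalerA. Qed.
Fact lend_scale1 : left_id 1 lend_scale.
Proof. by move=> f; apply: lendP => v /=; rewrite scale1r. Qed.
Fact lend_scaleDr : right_distributive lend_scale lend_add.
Proof. by move=> c f g; apply: lendP => v /=; rewrite scalerDr. Qed.
Fact lend_scaleDl f : {morph lend_scale^~ f : c d / c + d >-> lend_add c d}.
Proof. by move=> c d; apply: lendP => v /=; rewrite scalerDl. Qed.

HB.instance Definition _ := GRing.Zmodule_isLmodule.Build K (lend V)
  lend_scaleA lend_scale1 lend_scaleDr lend_scaleDl.

Fact lend_scaleAl c (f g : lend V) : c *: (f * g) = c *: f * g.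
Proof. exact: lendP. Qed.
Fact lend_scaleAr c (f g : lend V) : c *: (f * g) = f * (c *: g).
Proof. by apply: lendP => v /=; rewrite linearZ. Qed.

End EndomorphismAlgebra.

Section WeylAlgebra.
Variables (n : nat) (K : comNzRingType).

Definition diffop := lend {mpoly K[n]}.
HB.instance Definition _ := GRing.PzRing.on diffop.
HB.instance Definition _ := GRing.Lmodule.on diffop.

Fact diffop_oner_neq0 : (1 : diffop) != 0.
Proof.
apply/eqP => /(congr1 (fun P : diffop => P 1)) /= /eqP.
by rewrite oner_eq0.
Qed.
HB.instance Definition _ :=
  GRing.PzSemiRing_isNonZero.Build diffop diffop_oner_neq0.
HB.instance Definition _ :=
  GRing.Lmodule_isLalgebra.Build K diffop (@lend_scaleAl _ _).
HB.instance Definition _ :=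
  GRing.Lalgebra_isAlgebra.Build K diffop (@lend_scaleAr _ _).

Definition opX (i : 'I_n) : diffop :=
  ('X_i \*o idfun : {linear {mpoly K[n]} -> {mpoly K[n]}}).
Definition opD (i : 'I_n) : diffop :=
  (mderiv i : {linear {mpoly K[n]} -> {mpoly K[n]}}).

(** The Weyl algebra is the subalgebra of End_K(K[x_1, .., x_n]) generated by
    the multiplications by the x_i and the derivations d/dx_i; over a field of
    characteristic 0 it has the usual presentation. *)
Inductive weyl : set diffop :=
| weyl_scalar c : weyl c%:A
| weyl_opX i : weyl (opX i)
| weyl_opD i : weyl (opD i)
| weyl_add P Q : weyl P -> weyl Q -> weyl (P + Q)
| weyl_mul P Q : weyl P -> weyl Q -> weyl (P * Q).

Definition weyl_left_ideal m (L : 'I_m -> diffop) : set diffop :=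
  [set P | exists2 Q : 'I_m -> diffop,
     forall i, weyl (Q i) & P = \sum_(i < m) Q i * L i].

Definition theta (i : 'I_n) : diffop := opX i * opD i.

End WeylAlgebra.

Section System.
Variables (K : comNzRingType) (a : 'I_3 -> K) (B : 'M[K]_(2, 3)).

(** The variables of the system are (x_(v 1), x_(v 2)): since v only permutes
    the coordinates, the Euler operator of the i-th variable is theta (v i). *)
Definition hg_op (v : 'S_2) (i : 'I_2) : diffop 2 K :=
  \prod_(j < 3) ((B i j - 1)%:A + theta K (v i))
  - opX K (v i) * \prod_(j < 3) ((a j)%:A + \sum_(k < 2) theta K (v k)).

Definition hg_system (v : 'S_2) : set (diffop 2 K) :=
  weyl_left_ideal (hg_op v).

End System.

(** Row i (counted from 0) of the new matrix is
    (b_(t i, s_i 0), b_(t i, s_i 1), 1), where s_0 = s1 and s_1 = s2;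
    [lift ord_max] embeds the first two columns into 'I_3. *)
Definition permute_b (K : comNzRingType) (B : 'M[K]_(2, 3))
    (s1 s2 t : 'S_2) : 'M[K]_(2, 3) :=
  \matrix_(i < 2, j < 3)
    if unlift ord_max j is Some k then
      B (t i) (lift ord_max ((if i == ord0 then s1 else s2) k))
    else 1.

(** The triple (s1, s2; t) is determined by the permutation
    (i, j) |-> (t i, s_i j) of the positions of the entries b_ij, j <> 3,
    and D4 is the set of these permutations. *)
Definition triple_fun (s1 s2 t : 'S_2) (p : 'I_2 * 'I_2) : 'I_2 * 'I_2 :=
  (t p.1, (if p.1 == ord0 then s1 else s2) p.2).

Fact triple_fun_inj s1 s2 t : injective (triple_fun s1 s2 t).
Proof. by move=> [i j] [k l] [] /perm_inj<- /perm_inj<-. Qed.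

Definition triple_perm s1 s2 t : {perm 'I_2 * 'I_2} :=
  perm (@triple_fun_inj s1 s2 t).

Definition D4 : {set {perm 'I_2 * 'I_2}} :=
  [set triple_perm u.1.1 u.1.2 u.2 | u : 'S_2 * 'S_2 * 'S_2].

Fact D4_group_set : group_set D4.
Proof.
apply/group_setP; split.
  apply/imsetP; exists (1%g, 1%g, 1%g) => //; apply/permP => -[i j].
  by rewrite perm1 permE /triple_fun /= if_same !perm1.
move=> _ _ /imsetP[[[s1 s2] t] _ ->] /imsetP[[[r1 r2] u] _ ->] /=.
pose r (i : 'I_2) := if i == ord0 then r1 else r2.
apply/imsetP.
exists (s1 * r (t ord0), s2 * r (t (lift ord0 ord0)), t * u)%g => //.
apply/permP => -[i j]; rewrite permM !permE /triple_fun /= permM -/(r _).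
congr (_, _); case: (unliftP ord0 i) => [k ->|->]; last by rewrite eqxx permM.
by rewrite (ord1 k) permM.
Qed.

Canonical D4_group := Group D4_group_set.

(* Main.v *)
Require Import Defs.
From HB Require Import structures.
From mathcomp Require Import all_boot all_order all_algebra.
From mathcomp Require Import all_fingroup all_solvable.
From mathcomp Require Import boolp classical_sets reals.
From mathcomp Require Import complex mpoly.

(** The group of triples is the wreath product of S_2 by S_2: the exchange of
    the two rows conjugates the swap inside the first row into the swap inside
    the second one.  These two involutions therefore generate everything
    ([D4_gen]), and a group generated by two distinct involutions is dihedral;
    its order is 8 because distinct triples act differently on the positions
    of the b_ij ([card_D4]).

    The symmetry of the system holds because the new operators are the old
    ones, listed in another order ([hg_op_permute]).  In each operator, the
    factors of a product all have the form c + T for the same operator T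
    (T = theta_i, respectively T = theta_1 + theta_2), so the product is a
    polynomial in T.  It depends only on the multiset of the constants c, even
    though the Weyl algebra is not commutative ([prod_shift_perm]).  This
    absorbs sigma, sigma_1 and sigma_2.  The permutation tau acts on both the
    rows of B and the variables, so it turns the i-th operator into the
    tau(i)-th one, and a left ideal does not depend on the order of its
    generators ([weyl_left_ideal_perm]). *)

Import GRing.Theory.

Section TriplesFormDihedralGroup.

Local Open Scope group_scope.

Lemma triple_perm_rowsM s1 s2 r1 r2 u :
  triple_perm s1 s2 1 * triple_perm r1 r2 u =
    triple_perm (s1 * r1) (s2 * r2) u.
Proof.
apply/permP => -[i j]; rewrite permM !permE /triple_fun /= perm1.
by case: ifP; rewrite permM.
Qed.

Lemma triple_perm1 : triple_perm 1 1 1 = 1.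
Proof.
by apply/permP => -[i j]; rewrite perm1 permE /triple_fun /= if_same !perm1.
Qed.

Lemma triple_perm_inj s1 s2 t r1 r2 u :
  triple_perm s1 s2 t = triple_perm r1 r2 u -> (s1, s2, t) = (r1, r2, u).
Proof.
move=> /permP E.
have {}E i j : triple_fun s1 s2 t (i, j) = triple_fun r1 r2 u (i, j).
  by have := E (i, j); rewrite !permE.
congr (_, _, _); apply/permP => j.
- by case: (E ord0 j).
- by case: (E ord_max j).
- by case: (E j j).
Qed.

Lemma card_D4 : #|D4| = 8.
Proof.
rewrite card_imset => [|[[s1 s2] t] [[r1 r2] u] /triple_perm_inj //].
by rewrite !card_prod !card_Sn.
Qed.

Definition swap : 'S_2 := tperm ord0 ord_max.

Lemma swap_neq1 : swap != 1.
Proof. by apply/eqP => /permP/(_ ord0); rewrite perm1 tpermL. Qed.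

Lemma S2P (s : 'S_2) : s = 1 \/ s = swap.
Proof.
apply/set2P; suff -> : [set 1; swap] = [set: 'S_2] by rewrite inE.
apply/eqP; rewrite eqEcard finset.subsetT cardsT card_Sn cards2 eq_sym.
by rewrite swap_neq1.
Qed.

Definition flip_row0 := triple_perm swap 1 1.
Definition flip_rows := triple_perm 1 1 swap.

Lemma flip_rows_conj s1 s2 :
  triple_perm s1 s2 1 ^ flip_rows = triple_perm s2 s1 1.
Proof.
apply: (mulgI flip_rows); rewrite -conjgC; apply/permP => -[i j].
rewrite !permM !permE /triple_fun /= !(if_same, perm1); congr (_, _).
case: (unliftP ord0 i) => [k|] ->; last by rewrite tpermL.
have -> : lift ord0 k = ord_max by apply: val_inj; rewrite (ord1 k).
by rewrite tpermR.
Qed.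

Lemma order_flip_row0 : #[flip_row0] = 2.
Proof.
apply: nt_prime_order => //.
  by rewrite expgS expg1 triple_perm_rowsM tperm2 mulg1 triple_perm1.
apply/eqP; rewrite -triple_perm1 => /triple_perm_inj[/eqP].
by rewrite (negPf swap_neq1).
Qed.

Lemma order_flip_rows : #[flip_rows] = 2.
Proof.
apply: nt_prime_order => //.
  apply/permP => -[i j]; rewrite expgS expg1 permM !permE /triple_fun /=.
  by rewrite !if_same !perm1 tpermK.
apply/eqP; rewrite -triple_perm1 => /triple_perm_inj[/eqP].
by rewrite (negPf swap_neq1).
Qed.

(** A triple is the product of a permutation of the first row, a permutation
    of the second row, and a permutation of the two rows; the middle factor is
    obtained from the first kind by conjugation with [flip_rows]. *)
Lemma D4_gen : D4 = <<[set flip_row0; flip_rows]>>.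
Proof.
pose G := <<[set flip_row0; flip_rows]>>%G.
have Gx : flip_row0 \in G by rewrite mem_gen ?set21.
have Gy : flip_rows \in G by rewrite mem_gen ?set22.
apply/eqP; rewrite -[<<_>>]/(gval G) finset.eqEsubset gen_subG.
apply/andP; split.
  apply/fintype.subsetP => _ /imsetP[[[s1 s2] t] _ ->] /=.
  have G1 s : triple_perm s 1 1 \in G.
    by case: (S2P s) => ->; rewrite ?triple_perm1 ?group1.
  have Gt : triple_perm 1 1 t \in G.
    by case: (S2P t) => ->; rewrite ?triple_perm1 ?group1.
  have -> : triple_perm s1 s2 t =
      triple_perm s1 1 1 * triple_perm s2 1 1 ^ flip_rows * triple_perm 1 1 t.
    by rewrite flip_rows_conj !triple_perm_rowsM !mulg1 !mul1g.
  by apply: groupM; [exact: groupM (G1 s1) (groupJ (G1 s2) Gy) | exact: Gt].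
apply/fintype.subsetP => _ /set2P[] ->; apply/imsetP.
  by exists (swap, 1, 1).
by exists (1, 1, swap).
Qed.

Lemma D4_isog_dihedral : D4 \isog [set: 'D_8].
Proof.
have flips_neq : flip_row0 != flip_rows.
  by apply/eqP => /triple_perm_inj[/eqP]; rewrite (negPf swap_neq1).
have := involutions_gen_dihedral order_flip_row0 order_flip_rows flips_neq.
by rewrite -D4_gen card_D4.
Qed.

End TriplesFormDihedralGroup.

Local Open Scope ring_scope.

(** Both products are values at T of products in K[X], where the factors may
    be reordered. *)
Lemma prod_shift_perm (K : comNzRingType) (A : algType K) (T : A)
    (I : finType) (c : I -> K) (s : {perm I}) :
  \prod_j ((c (s j))%:A + T) = \prod_j ((c j)%:A + T).
Proof.
have prodE (d : I -> K) :
    \prod_j ((d j)%:A + T) = horner_alg T (\prod_j ((d j)%:P + 'X)).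
  rewrite rmorph_prod; apply: eq_bigr => j _.
  by rewrite rmorphD /= horner_algC horner_algX.
by rewrite !prodE [in RHS](reindex_perm s).
Qed.

Lemma weyl_left_ideal_perm (n : nat) (K : comNzRingType) (m : nat)
    (L : 'I_m -> diffop n K) (t : 'S_m) :
  weyl_left_ideal (fun i => L (t i)) = weyl_left_ideal L.
Proof.
apply/seteqP; split=> P [Q WQ ->].
  exists (fun i => Q (t^-1%g i)) => [i|]; first exact: WQ.
  by rewrite [RHS](reindex_perm t); apply: eq_bigr => i _; rewrite permK.
exists (fun i => Q (t i)) => [i|]; first exact: WQ.
by rewrite [LHS](reindex_perm t).
Qed.

Definition column_perm (s : 'S_2) : 'S_3 := lift_perm ord_max ord_max s.

(** Since the last column of B consists of 1s, the entry 1 that [permute_b]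
    puts there is again an entry of B, and row i of the new matrix is row t i
    of B up to a permutation of all three columns. *)
Lemma permute_bE (K : comNzRingType) (B : 'M[K]_(2, 3)) (s1 s2 t : 'S_2)
    (i : 'I_2) (j : 'I_3) :
  (forall i : 'I_2, B i ord_max = 1) ->
  permute_b B s1 s2 t i j =
    B (t i) (column_perm (if i == ord0 then s1 else s2) j).
Proof.
move=> hB; rewrite mxE.
by case: unliftP => [k ->|->]; rewrite (lift_perm_lift, lift_perm_id) ?hB.
Qed.

Lemma hg_op_permute (K : comNzRingType) (a : 'I_3 -> K) (B : 'M[K]_(2, 3))
    (s : 'S_3) (s1 s2 t : 'S_2) (i : 'I_2) :
  (forall i : 'I_2, B i ord_max = 1) ->
  hg_op (fun j => a (s j)) (permute_b B s1 s2 t) t i = hg_op a B 1%g (t i).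
Proof.
move=> hB; rewrite /hg_op perm1; congr (_ - _ * _); last first.
  rewrite prod_shift_perm [in RHS](reindex_perm t) /=.
  by under [in RHS]eq_bigr do under eq_bigr do rewrite perm1.
rewrite -(prod_shift_perm _ _ _ _ (fun j => B (t i) j - 1)
  (column_perm (if i == ord0 then s1 else s2))).
by apply: eq_bigr => j _; rewrite permute_bE.
Qed.

Theorem proposition2p4 (R : realType) (a : 'I_3 -> R[i]) (B : 'M[R[i]]_(2, 3))
    (hB : forall i : 'I_2, B i ord_max = 1) :
  (D4 \isog [set: 'D_8])%g /\
  forall (s : 'S_3) (s1 s2 t : 'S_2),
    hg_system a B 1%g =
    hg_system (fun j => a (s j)) (permute_b B s1 s2 t) t.
Proof.
split=> [|s s1 s2 t]; first exact: D4_isog_dihedral.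
rewrite /hg_system -(weyl_left_ideal_perm _ _ _ _ t); congr weyl_left_ideal.
by apply/funext => i; rewrite hg_op_permute.
Qed.
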